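(* Let $n,\Delta,f$ be nonnegative integers with $f\Delta\cdot 2^{f\Delta}\le n$. Then there exists an edge-colored directed graph $G$ on $\Theta(n)$ vertices, in which every color class has at most $\Delta$ edges, with a source vertex $s$, such that every $f$-CFT $\{s\}\times V$ reachability preserver of $G$ has $\Omega(2^{f\Delta} n)$ edges.
   Context: An edge-colored graph assigns each edge exactly one color (or, equivalently for uncolored edges, a unique color used nowhere else), with no restrictions; a color class is the set of edges of one color. For a set $F$ of colors, $G-F$ denotes $G$ with all edges whose color is in $F$ deleted. A subgraph $H\subseteq G$ is an $f$-CFT $\{s\}\times V$ reachability preserver if for every set $F$ of at most $f$ colors and every vertex $t$, $t$ is reachable from $s$ in $H-F$ if and only if $t$ is reachable from $s$ in $G-F$.
   Formalization: The formal theorem takes n and Δ positive rather than nonnegative: for Δ = 0 and n ≥ 1 the graph can have no edges, so the lower bound fails, and for n = 0 a graph with a source vertex cannot have Θ(0) vertices. *)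

(* Defs.v *)
From mathcomp Require Import all_boot all_order all_algebra.

Set Implicit Arguments.
Unset Strict Implicit.
Unset Printing Implicit Defensive.

(* A finite simple directed graph whose edges are colored.  [ecolor] is total
   on pairs, but only its values on edges are ever used: an uncolored edge is
   an edge whose color is shared with no other edge. *)
Record ecDigraph := EcDigraph {
  vertex :> finType;
  color : finType;
  edges : {set vertex * vertex};
  ecolor : vertex * vertex -> color;
  edges_irrefl : forall x : vertex, (x, x) \notin edges
}.

Definition color_class (G : ecDigraph) (c : color G) : {set G * G} :=
  [set e in edges G | ecolor e == c].

Definition del_colors (G : ecDigraph) (E : {set G * G}) (F : {set color G}) :
    {set G * G} :=
  [set e in E | ecolor e \notin F].

Definition reachable (V : finType) (E : {set V * V}) (s t : V) : bool :=
  connect (fun x y => (x, y) \in E) s t.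

(* A subgraph is given by its edge set, on the same vertices as [G]. *)
Definition CFT_preserver (G : ecDigraph) (f : nat) (s : G)
    (H : {set G * G}) : Prop :=
  H \subset edges G /\
  forall F : {set color G}, #|F| <= f ->
  forall t : G,
    reachable (del_colors H F) s t <-> reachable (del_colors (edges G) F) s t.

(* Main.v *)
(** Take the complete binary tree of depth [d = f * Delta] and subdivide the
    edge entering each node [v] into a path with one edge per leaf below the
    sibling of [v].  For every leaf [l], the subdivided edges contain exactly
    [d] edges assigned to [l], one on each path that branches off the way to
    [l]; they receive [f] colors private to [l], each used [Delta] times.
    Deleting these [f] colors cuts off every leaf but [l].  Join every leaf to
    each of [n] sinks: after that deletion a sink [t] is reachable only through
    the edge from [l] to [t], so a preserver keeps all [2 ^ d * n] such edges. *)
Require Import Defs.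
From mathcomp Require Import all_boot all_order all_algebra.
From mathcomp Require Import zify.
Import Order.TTheory GRing.Theory Num.Theory.
Local Open Scope ring_scope.

Lemma connect_closed (T : finType) (e : rel T) (P : pred T) (x y : T) :
  (forall u v, e u v -> P u -> P v) -> connect e x y -> P x -> P y.
Proof.
move=> clP /connectP[p + ->] {y}.
elim: p x => [|z p IHp] x //= /andP[exz pathp] Px.
exact: IHp pathp (clP _ _ exz Px).
Qed.

(** * Arithmetic of sibling blocks and of the subdivided tree *)

Section Sibling.
Local Open Scope nat_scope.

Definition sib (q : nat) : nat := ~~ odd q + q./2.*2.

Lemma odd_sib q : odd (sib q) = ~~ odd q.
Proof. by rewrite oddD odd_double addbF oddb. Qed.

Lemma half_sib q : (sib q)./2 = q./2.
Proof. exact: half_bit_double. Qed.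

Lemma sibK : involutive sib.
Proof. by move=> q; rewrite {1}/sib odd_sib half_sib negbK odd_double_half. Qed.

Lemma sib_neq q : sib q != q.
Proof. by apply/eqP => /(congr1 odd); rewrite odd_sib; case: odd. Qed.

Lemma half_eq_sib q r : q./2 = r./2 -> q != r -> q = sib r.
Proof.
rewrite -{2 3}(odd_double_half q) -{2}(odd_double_half r) /sib => ->.
by rewrite eqn_add2r; case: (odd q); case: (odd r).
Qed.

(** Flipping bit [h] sends a leaf to the one at the same offset in the sibling block of size
    [2 ^ h]. *)
Definition flip (h x : nat) : nat := sib (x %/ 2 ^ h) * 2 ^ h + x %% 2 ^ h.

Lemma divn_expS x h : x %/ 2 ^ h.+1 = (x %/ 2 ^ h)./2.
Proof. by rewrite expnSr divnMA divn2. Qed.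

Lemma flip_div h x : flip h x %/ 2 ^ h = sib (x %/ 2 ^ h).
Proof.
have pos : 0 < 2 ^ h by rewrite expn_gt0.
by rewrite /flip divnMDl // (divn_small (ltn_pmod x pos)) addn0.
Qed.

Lemma flip_mod h x : flip h x %% 2 ^ h = x %% 2 ^ h.
Proof. by rewrite modnMDl modn_mod. Qed.

Lemma flipK h : involutive (flip h).
Proof. by move=> x; rewrite {1}/flip flip_div flip_mod sibK -divn_eq. Qed.

Lemma ltn_flip h d x : h < d -> x < 2 ^ d -> flip h x < 2 ^ d.
Proof.
move=> hd xd; have E : 2 ^ d = 2 ^ (d - h.+1) * 2 ^ h.+1 by rewrite -expnD subnK.
by move: xd; rewrite E -!ltn_divLR ?expn_gt0 // !divn_expS flip_div half_sib.
Qed.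

(* The vertex [(h, x)] lies on the path entering the tree node of height [h]
   whose leaves are the block [x %/ 2 ^ h]; the last [x] of the block is the
   node itself, and the path starts at the parent node, of height [h.+1]. *)
Definition par (h x : nat) : nat * nat :=
  if 2 ^ h %| x then (h.+1, ((x %/ 2 ^ h.+1).+1 * 2 ^ h.+1).-1) else (h, x.-1).

Lemma par_neq h x : par h x != (h, x).
Proof.
rewrite /par; case: ifP => hx; rewrite xpair_eqE; first by lia.
by case: x hx => [|x _]; rewrite ?dvdn0 // eqxx /=; lia.
Qed.

Lemma divn_pred h x : ~~ (2 ^ h %| x) -> x.-1 %/ 2 ^ h = x %/ 2 ^ h.
Proof.
move=> hx; have x0 : 0 < x by case: x hx => //; rewrite dvdn0.
by rewrite -{2}(prednK x0) divnS ?expn_gt0 // prednK // (negbTE hx).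
Qed.

Lemma divn_last q m : 0 < m -> (q.+1 * m).-1 %/ m = q.
Proof.
move=> m0; have -> : (q.+1 * m).-1 = q * m + m.-1 by rewrite mulSn; lia.
by rewrite divnMDl // divn_small ?addn0 // prednK.
Qed.

(* Satisfied by every vertex still reachable once the edges assigned to [l] are cut. *)
Definition alive (l h x : nat) : bool :=
  (x %/ 2 ^ h.+1 == l %/ 2 ^ h.+1) &&
  ((x %/ 2 ^ h == l %/ 2 ^ h) || (x < flip h l)).

Lemma alive_root l d x : x < 2 ^ d -> l < 2 ^ d -> alive l d x.
Proof. by move=> xd ld; rewrite /alive !divn_expS !(divn_small xd) (divn_small ld). Qed.

Lemma alive_leaf l x : alive l 0 x -> x = l.
Proof.
rewrite /alive divn_expS (divn_expS l) /flip !expn0 !divn1 modn1 muln1 addn0.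
by case/andP=> /eqP xl; case: (x =P l) => //= /eqP /(half_eq_sib _ _ xl) ->; lia.
Qed.

(** On a path branching off the way to [l], [alive] ends just before the cut vertex [flip h l], so
    it never passes on to the subtree below. *)
Lemma alive_par l h x : flip h x != l ->
  alive l (par h x).1 (par h x).2 -> alive l h x.
Proof.
move=> xl; have {}xl : x != flip h l by apply: contra xl => /eqP->; rewrite flipK.
have pos k : 0 < 2 ^ k by rewrite expn_gt0.
rewrite /par; case: ifPn => hx /=; rewrite /alive.
  set y := (_.-1); have yE : y %/ 2 ^ h.+1 = x %/ 2 ^ h.+1 by rewrite divn_last ?expn_gt0.
  case/andP => y2; case: (y %/ 2 ^ h.+1 =P l %/ 2 ^ h.+1) => [yl _|/eqP yl /= ylt].
    rewrite -yE yl eqxx /=.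
    case: (x %/ 2 ^ h =P l %/ 2 ^ h) => //= /eqP xh.
    have xs : x %/ 2 ^ h = sib (l %/ 2 ^ h).
      by apply: half_eq_sib => //; rewrite -!divn_expS -yE.
    (* Here [x] is the first vertex of the sibling block, hence at most [flip h l]. *)
    rewrite ltn_neqAle xl /= -(divnK hx) xs -flip_div.
    exact: leq_divM.
  (* Contradiction: [y] ends the sibling block, so it cannot precede [flip h.+1 l]. *)
  move: y2; rewrite !(divn_expS _ h.+1) => /eqP /half_eq_sib /(_ yl) ys.
  have := ltn_ceil (flip h.+1 l) (pos h.+1).
  rewrite flip_div -ys yE -/y; move: ylt; rewrite /y; lia.
rewrite !divn_expS (divn_pred _ _ hx) => /andP[-> /=].
case: eqP => //= _ xlt; rewrite ltn_neqAle xl /=; lia.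
Qed.

Lemma alive_flip l h x : x %/ 2 ^ h = l %/ 2 ^ h -> flip h x != l.
Proof.
move=> xl; apply/eqP => fl; have := sib_neq (x %/ 2 ^ h).
by rewrite -flip_div fl xl eqxx.
Qed.

End Sibling.

(** * The colored graph, its size and its color classes *)

Section Construction.
Variables n Delta f : nat.
Hypothesis Delta_gt0 : (0 < Delta)%N.
Local Open Scope nat_scope.

Let d := f * Delta.
Let node : finType := ('I_d.+1 * 'I_(2 ^ d))%type.
Let V : finType := (node + 'I_n)%type.
Let C : finType := ('I_(2 ^ d).+1 * 'I_d.+1 + V * V)%type.

(* At height [d] only the last vertex, the root, is connected to the others. *)
Definition tree_edge (u v : node) : bool :=
  (v.1 < d) && ((val u.1, val u.2) == par v.1 v.2).

Definition lb_edge (e : V * V) : bool :=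
  match e with
  | (inl u, inl v) => tree_edge u v
  | (inl u, inr _) => val u.1 == 0
  | _ => false
  end.

(* The edge entering [(h, x)] is assigned to the leaf [flip h x]; the [d] levels
   are cut into [f] runs of [Delta], one color per leaf and run. *)
Definition lb_color (e : V * V) : C :=
  match e.2 with
  | inl v => inl (inord (flip v.1 v.2), inord (v.1 %/ Delta))
  | inr _ => inr e
  end.

Lemma lb_irrefl (x : V) : (x, x) \notin [set e | lb_edge e].
Proof.
rewrite inE; case: x => //= -[h x]; rewrite /tree_edge /= eq_sym.
by rewrite (negbTE (par_neq _ _)) andbF.
Qed.

Definition lb_graph : ecDigraph := @EcDigraph V C [set e | lb_edge e] lb_color lb_irrefl.

Lemma last_subproof : (2 ^ d).-1 < 2 ^ d.
Proof. by rewrite prednK // expn_gt0. Qed.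

Definition lb_source : lb_graph := inl (ord_max, Ordinal last_subproof).

Lemma card_lb_graph : #|lb_graph| = d.+1 * 2 ^ d + n.
Proof. by rewrite card_sum card_prod !card_ord. Qed.

(** A sink edge has a color of its own. A tree edge is recovered from its color and its height
    modulo [Delta]: run and residue give the height, the involution [flip] the position, and [par]
    the tail. *)
Lemma lb_color_class (k : color lb_graph) : #|color_class k| <= Delta.
Proof.
case: k => [[l k]|e]; last first.
  apply: leq_trans Delta_gt0; apply: (leq_trans _ (eq_leq (cards1 e))).
  apply: subset_leq_card.
  by apply/subsetP => -[u [v|v]]; rewrite !inE => /andP[_] //=.
pose g (e : V * V) : 'I_Delta :=
  Ordinal (ltn_pmod (if e.2 is inl v then val v.1 else 0) Delta_gt0).
have g_inj : {in color_class (inl (l, k) : color lb_graph) &, injective g}.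
  move=> [[u|u] [v|v]] [[u'|u'] [v'|v']]; rewrite !inE //= ?andbF //.
  move=> /andP[/andP[v1 /eqP uv] /eqP[vl vk]] /andP[/andP[v1' /eqP uv'] /eqP[vl' vk']].
  move=> /(congr1 val) /= gE.
  have hE : v.1 = v'.1 :> nat.
    rewrite (divn_eq v.1 Delta) (divn_eq v'.1 Delta) gE; congr (_ * _ + _).
    have bnd (w : 'I_d.+1) : w %/ Delta < d.+1 by apply: leq_ltn_trans (leq_div _ _) _.
    by rewrite -(inordK (bnd v.1)) -(inordK (bnd v'.1)) vk vk'.
  have xE : v.2 = v'.2 :> nat.
    apply: (can_inj (flipK v.1)).
    have bnd (w : node) : w.1 < d -> flip w.1 w.2 < (2 ^ d).+1.
      by move=> wd; apply/ltnW/ltn_flip.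
    by rewrite {2}hE -(inordK (bnd _ v1)) -(inordK (bnd _ v1')) vl vl'.
  move: uv; rewrite hE xE -uv' => -[u1 u2].
  have pE (a b : node) : a.1 = b.1 :> nat -> a.2 = b.2 :> nat -> a = b.
    by case: a b => [a1 a2] [b1 b2] /= /val_inj -> /val_inj ->.
  by rewrite (pE u u') // (pE v v').
by rewrite -(card_in_imset g_inj) (leq_trans (max_card _)) ?card_ord.
Qed.

(** * Reachability under the faults of one leaf *)

Definition leaf_faults (l : 'I_(2 ^ d)) : {set color lb_graph} :=
  [set (inl (inord l, inord k) : C) | k : 'I_f].

Lemma card_leaf_faults l : #|leaf_faults l| <= f.
Proof. by apply: leq_trans (leq_imset_card _ _) _; rewrite card_ord. Qed.

Lemma mem_leaf_faults l (u : V) (v : node) : v.1 < d ->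
  (lb_color (u, inl v) \in leaf_faults l) = (flip v.1 v.2 == l).
Proof.
move=> vd; apply/imsetP/eqP => [[k _] [/(congr1 val) + _]|fl].
  by rewrite /= !inordK ?ltnS; [|exact: ltnW|exact/ltnW/ltn_flip].
have vf : v.1 %/ Delta < f by rewrite ltn_divLR.
by exists (Ordinal vf) => //; rewrite /lb_color /= fl.
Qed.

Lemma sink_notin_leaf_faults l (u : V) (t : 'I_n) :
  lb_color (u, inr t) \notin leaf_faults l.
Proof. by apply/imsetP => -[]. Qed.

(** Going back along [par] to the root stays in blocks containing [l]; an edge entering such a block
    is assigned to a leaf of the sibling block, so it survives. *)
Lemma reachable_leaf_block (l : 'I_(2 ^ d)) (h : 'I_d.+1) (x : 'I_(2 ^ d)) :
    x %/ 2 ^ h = l %/ 2 ^ h -> (val h = d -> val x = (2 ^ d).-1) ->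
  reachable (del_colors (edges lb_graph) (leaf_faults l)) lb_source (inl (h, x)).
Proof.
(* This measure drops along [par]: either [x] decreases, or the height grows, which removes [2 ^ d]
   while the new position is below [2 ^ d]. *)
have [m] := ubnP ((d - h) * 2 ^ d + x).
elim: m h x => // m IHm h x; rewrite ltnS => hxm xl xd.
have [hd|hd] := eqVneq (val h) d.
  have -> : (inl (h, x) : lb_graph) = lb_source; last exact: connect0.
  by congr (inl (_, _)); apply: val_inj => //=; apply: xd.
have {xd} hd : h < d by rewrite ltn_neqAle hd -ltnS ltn_ord.
suff [u [u1 u2 u3]] : exists u : node,
    [/\ (val u.1, val u.2) = par h x,
        u.2 %/ 2 ^ u.1 = l %/ 2 ^ u.1 /\ (val u.1 = d -> val u.2 = (2 ^ d).-1)
      & (d - u.1) * 2 ^ d + u.2 < (d - h) * 2 ^ d + x].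
  case: u2 => u2 u2'; apply: (@connect_trans _ _ (inl u)).
    by case: u u1 u2 u2' u3 => u v _ /= ? ? ?; apply: IHm => //; lia.
  apply: connect1; rewrite !inE /= /tree_edge hd u1 eqxx /=.
  by rewrite mem_leaf_faults //= alive_flip.
rewrite /par; case: ifPn => hx.
  have E : 2 ^ d = 2 ^ (d - h.+1) * 2 ^ h.+1 by rewrite -expnD subnK.
  set y := (_.-1).
  have yE : y %/ 2 ^ h.+1 = x %/ 2 ^ h.+1 by rewrite divn_last ?expn_gt0.
  have yd : y < 2 ^ d by rewrite E -ltn_divLR ?expn_gt0 // yE ltn_divLR ?expn_gt0 // -E.
  have hd' : h.+1 < d.+1 by [].
  exists (Ordinal hd', Ordinal yd); split => //=.
    rewrite yE !divn_expS xl; split=> // hdE.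
    by rewrite /y hdE divn_small // mul1n.
  have -> : d - h = (d - h.+1).+1 by lia.
  by rewrite mulSn; move: ((d - h.+1) * 2 ^ d) => z; lia.
have xd : x.-1 < 2 ^ d by apply: leq_ltn_trans (leq_pred _) (ltn_ord x).
exists (h, Ordinal xd); split => //=.
  by rewrite divn_pred //; split=> // hE; move: hd; rewrite hE ltnn.
by move: hx; case: (val x) => [|x']; rewrite ?dvdn0 //; lia.
Qed.

Definition leaf (l : 'I_(2 ^ d)) : lb_graph := inl (ord0, l).

Lemma reachable_leaf (l : 'I_(2 ^ d)) :
  reachable (del_colors (edges lb_graph) (leaf_faults l)) lb_source (leaf l).
Proof.
apply: reachable_leaf_block => //= d0.
have d1 : 2 ^ d = 1 by rewrite -d0.
move: (ltn_ord l); lia.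
Qed.

Lemma sink_edge_in_preserver (H : {set lb_graph * lb_graph}) (l : 'I_(2 ^ d)) (t : 'I_n) :
  CFT_preserver f lb_source H -> (leaf l, inr t : lb_graph) \in H.
Proof.
move=> [/subsetP HG presH]; apply/negPn/negP => ltH.
have reach_t : reachable (del_colors H (leaf_faults l)) lb_source (inr t).
  apply/presH; first exact: card_leaf_faults.
  apply: connect_trans (reachable_leaf l) (connect1 _).
  by rewrite !inE /= sink_notin_leaf_faults.
(* Without the edge from [l] to [t], the remaining edges of [H] preserve [P], as [l] is the only
   alive leaf. *)
pose P (v : lb_graph) := match v with
  | inl v => alive l v.1 v.2 | inr t' => t' != t end.
suff: P (inr t) by rewrite /P eqxx.
apply: connect_closed reach_t _; last exact: alive_root.
move=> u v; rewrite inE => /andP[uvH cuv]; have := HG _ uvH; rewrite inE /=.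
case: v u uvH cuv => [v|t'] [u|t''] //= uvH.
  move=> + /andP[vd /eqP uv]; rewrite mem_leaf_faults // => fv Pu.
  by apply: alive_par fv _; rewrite -uv.
move=> _ /eqP u0 Pu; apply: contraNneq ltH => <-.
rewrite /leaf; have <- // : u = (ord0, l).
case: u u0 Pu {uvH} => [h x] /= h0; rewrite h0 => /alive_leaf xl.
by congr (_, _); apply: val_inj.
Qed.

Lemma card_preserver (H : {set lb_graph * lb_graph}) :
  CFT_preserver f lb_source H -> 2 ^ d * n <= #|H|.
Proof.
move=> presH; pose g (p : 'I_(2 ^ d) * 'I_n) := (leaf p.1, inr p.2 : lb_graph).
have g_inj : injective g by move=> [l t] [l' t'] [-> ->].
have <- : #|g @: setT| = 2 ^ d * n.
  by rewrite card_imset // cardsT card_prod !card_ord.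
apply: subset_leq_card; apply/subsetP => _ /imsetP[[l t] _ ->].
exact: sink_edge_in_preserver.
Qed.

End Construction.

Theorem theorem5p2 :
  exists a b c : rat,
    [/\ 0 < a, 0 < b & 0 < c] /\
    forall n Delta f : nat,
      (0 < n)%N -> (0 < Delta)%N ->
      (f * Delta * 2 ^ (f * Delta) <= n)%N ->
      exists (G : ecDigraph) (s : G),
        [/\ a * n%:R <= #|G|%:R <= b * n%:R,
            forall k : color G, (#|color_class k| <= Delta)%N
          & forall H : {set G * G}, CFT_preserver f s H ->
              c * (2 ^+ (f * Delta) * n%:R) <= #|H|%:R].
Proof.
(* With [d = f * Delta], the [d.+1 * 2 ^ d + n] vertices number at most [3 * n], since [n] bounds
   both [d * 2 ^ d] and [2 ^ d]; the latter uses [0 < n] when [d = 0]. *)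
exists 1, 3, 1; split=> // n Delta f n0 D0 dn.
exists (lb_graph n Delta f), (lb_source n Delta f); split.
- rewrite card_lb_graph mul1r -natrM !ler_nat leq_addl /=.
  have : (2 ^ (f * Delta) <= n)%N.
    case: (f * Delta)%N dn => [//|m] dn; apply: leq_trans dn.
    by rewrite leq_pmull.
  by rewrite mulSn; lia.
- exact: lb_color_class.
- move=> H presH; rewrite mul1r -natrX -natrM ler_nat.
  exact: card_preserver.
Qed.
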